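(* $$\frac{12}{83-90G}=\mathrm{CF}\left[3n^2+17n+23,\,-2n(n+1)(n+3)^2\right],$$ where $G$ is Catalan's constant.
   Context: For sequences $(a_n)_{n\ge0}$, $(b_n)_{n\ge1}$, $\mathrm{CF}[a_n,b_n]$ denotes the continued fraction $a_0+\cfrac{b_1}{a_1+\cfrac{b_2}{a_2+\ddots}}$, whose value is $\lim_{n\to\infty}A_n/B_n$, where $A_0=1$, $A_1=a_0$, $B_0=0$, $B_1=1$, and $A_{n+1}=a_nA_n+b_nA_{n-1}$, $B_{n+1}=a_nB_n+b_nB_{n-1}$ for $n\ge1$. Catalan's constant is $G=\sum_{k=0}^\infty \frac{(-1)^k}{(2k+1)^2}$. *)

(* Defs.v *)
From Stdlib Require Import Reals.
From Coquelicot Require Import Coquelicot.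
Open Scope R_scope.

(* Numerators and denominators of a_0 + b_1/(a_1 + b_2/(a_2 + ...)), with the
   index shifted by one: cf_num a b (S n) / cf_den a b (S n) is the convergent
   ending in a_n. The entry b 0 is never used. *)
Fixpoint cf_num (a b : nat -> R) (n : nat) : R :=
  match n with
  | O => 1
  | S m =>
      match m with
      | O => a O
      | S p => a m * cf_num a b m + b m * cf_num a b p
      end
  end.

Fixpoint cf_den (a b : nat -> R) (n : nat) : R :=
  match n with
  | O => 0
  | S m =>
      match m with
      | O => 1
      | S p => a m * cf_den a b m + b m * cf_den a b p
      end
  end.

(* Since division is total, the quotients A_n / B_n are required to be genuine
   for all large n (B_0 = 0, so this cannot hold for every n). *)
Definition is_CF (a b : nat -> R) (l : R) : Prop :=
  (exists N : nat, forall n : nat, (N <= n)%nat -> cf_den a b n <> 0) /\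
  is_lim_seq (fun n => cf_num a b n / cf_den a b n) (Finite l).

Definition Catalan : R :=
  Series (fun k : nat => (-1) ^ k / (2 * INR k + 1) ^ 2).

(* Main.v *)
(* Up to the factor (n+2)!^2, the recurrence of the continued fraction is
   contiguous to (n+1)^2 u_{n+1} = (3n^2+3n+1) u_n - 2n^2 u_{n-1}, whose bounded
   solution is the well-poised alternating series
     M_n = 2 sum_j (-1)^j n! (n+j)!/j! ((1/2)_j / (3/2)_{n+j})^2,
   with M_0 = 2G and M_1 = 2G - 1. Hence (83-90G) A_n - 12 B_n is (n+2)!^2 times a
   combination of M_{n+1} and M_{n+2} with coefficients of polynomial growth, while
   B_n grows at least like (n+2)!^2 (3/2)^n; so (83-90G) A_n/B_n -> 12, which also
   forces 83-90G <> 0. *)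
Require Import Defs.
From Stdlib Require Import Reals Arith Lra Lia.
From Coquelicot Require Import Coquelicot.
Open Scope R_scope.

(** * Telescoping and the dominating series of [odd_inv_sq] *)

Lemma is_series_telescope (h : nat -> R) :
  is_lim_seq h 0 -> is_series (fun j => h (S j) - h j) (- h O).
Proof.
  intros Hh.
  change (is_lim_seq (sum_n (fun j => h (S j) - h j)) (- h O)).
  apply (is_lim_seq_ext (fun n => h (S n) - h O)).
  - induction n as [|n IH].
    + now rewrite sum_O.
    + rewrite sum_Sn, <- IH; unfold plus; simpl; ring.
  - replace (- h O) with (0 - h O) by ring.
    apply is_lim_seq_minus'; [|apply is_lim_seq_const].
    now apply is_lim_seq_incr_1 in Hh.
Qed.

Definition odd_inv_sq (j : nat) : R := / (2 * INR j + 1) ^ 2.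

Lemma odd_inv_sq_pos (j : nat) : 0 < odd_inv_sq j.
Proof.
  unfold odd_inv_sq; pose proof (pos_INR j).
  apply Rinv_0_lt_compat, pow_lt; lra.
Qed.

Lemma is_lim_seq_inv_succ : is_lim_seq (fun j => / (INR j + 1)) 0.
Proof.
  apply (is_lim_seq_ext (fun n => / INR (S n))).
  - intros n; now rewrite S_INR.
  - apply (is_lim_seq_incr_1 (fun n => / INR n)).
    replace (Finite 0) with (Rbar_inv p_infty) by reflexivity.
    apply is_lim_seq_inv; [apply is_lim_seq_INR | discriminate].
Qed.

Lemma odd_inv_sq_le_inv_succ (j : nat) : odd_inv_sq j <= / (INR j + 1).
Proof.
  unfold odd_inv_sq; pose proof (pos_INR j).
  apply Rinv_le_contravar; nra.
Qed.

Lemma is_lim_seq_odd_inv_sq : is_lim_seq odd_inv_sq 0.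
Proof.
  apply (is_lim_seq_le_le (fun _ => 0) _ (fun j => / (INR j + 1))).
  - intros j; split; [apply Rlt_le, odd_inv_sq_pos | apply odd_inv_sq_le_inv_succ].
  - apply is_lim_seq_const.
  - apply is_lim_seq_inv_succ.
Qed.

Lemma ex_series_odd_inv_sq : ex_series odd_inv_sq.
Proof.
  apply (ex_series_le (K := R_AbsRing) (V := R_CompleteNormedModule) _
    (* Telescoping majorant [2 / ((j+1)(j+2))]; the factor 2 gives equality at [j = 0]. *)
    (fun j => 2 * (/ (INR j + 1) - / (INR (S j) + 1)))).
  - intros j; change (Rabs (odd_inv_sq j) <= 2 * (/ (INR j + 1) - / (INR (S j) + 1))).
    rewrite Rabs_pos_eq by apply Rlt_le, odd_inv_sq_pos.
    rewrite S_INR; unfold odd_inv_sq; pose proof (pos_INR j).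
    replace (2 * (/ (INR j + 1) - / (INR j + 1 + 1)))
      with (/ ((INR j + 1) * (INR j + 2) / 2)) by (field; lra).
    apply Rinv_le_contravar; nra.
  - apply (ex_series_scal_l 2 (fun j => / (INR j + 1) - / (INR (S j) + 1))).
    exists (- - / (INR 0 + 1)).
    apply (is_series_ext (fun j => (- / (INR (S j) + 1)) - (- / (INR j + 1)))).
    + intros j; simpl; ring.
    + apply (is_series_telescope (fun j => - / (INR j + 1))).
      replace (Finite 0) with (Rbar_opp 0) by (simpl; f_equal; ring).
      apply -> is_lim_seq_opp; apply is_lim_seq_inv_succ.
Qed.

(** * The alternating series [csum] and its recurrence *)

(* Summand of M_n in the header. *)
Fixpoint cterm (n j : nat) : R :=
  match n with
  | O => 2 * ((-1) ^ j * odd_inv_sq j)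
  | S m => cterm m j * (4 * (INR m + 1) * (INR m + 1 + INR j)
                        / (2 * INR j + 2 * INR m + 3) ^ 2)
  end.

Definition csum (n : nat) : R := Series (cterm n).

(** [cterm] recurses on [n], so its hypergeometric ratio in [j] has to come from induction on [n].
    With both ratios known, identities between shifted terms become rational ones. *)
Lemma cterm_succ_r (n j : nat) :
  cterm n (S j) = - cterm n j * ((INR n + INR j + 1) * (2 * INR j + 1) ^ 2
                  / ((INR j + 1) * (2 * INR j + 2 * INR n + 3) ^ 2)).
Proof.
  pose proof (pos_INR j).
  induction n as [|n IH]; cbn [cterm].
  - unfold odd_inv_sq; rewrite S_INR, <- tech_pow_Rmult; simpl INR.
    generalize ((-1) ^ j) as e; intros e; field; repeat split; lra.
  - pose proof (pos_INR n); rewrite IH, !S_INR; field; repeat split; lra.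
Qed.

(** Each step in [n] multiplies by a factor in [0,1], because [4(n+1)(n+1+j) <= (2j+2n+3)^2].
    Uniformity in [n] is what keeps [csum] bounded. *)
Lemma cterm_abs_le (n j : nat) : Rabs (cterm n j) <= 2 * odd_inv_sq j.
Proof.
  pose proof (odd_inv_sq_pos j).
  induction n as [|n IH]; cbn [cterm].
  - rewrite !Rabs_mult, pow_1_abs, !Rabs_pos_eq; lra.
  - pose proof (pos_INR n); pose proof (pos_INR j).
    rewrite Rabs_mult; replace (2 * odd_inv_sq j) with (2 * odd_inv_sq j * 1) by ring.
    apply Rmult_le_compat; try apply Rabs_pos; [exact IH|].
    rewrite Rabs_pos_eq.
    + apply Rle_div_l; [apply pow_lt; lra | nra].
    + apply Rle_mult_inv_pos; [nra | apply pow_lt; lra].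
Qed.

Lemma ex_series_cterm (n : nat) : ex_series (cterm n).
Proof.
  apply (ex_series_le (K := R_AbsRing) (V := R_CompleteNormedModule) _
    (fun j => 2 * odd_inv_sq j)).
  - intros j; apply cterm_abs_le.
  - apply (ex_series_scal_l 2 odd_inv_sq), ex_series_odd_inv_sq.
Qed.

Lemma csum_abs_le (n : nat) : Rabs (csum n) <= 2 * Series odd_inv_sq.
Proof.
  assert (H2 : ex_series (fun j => 2 * odd_inv_sq j))
    by (apply (ex_series_scal_l 2 odd_inv_sq), ex_series_odd_inv_sq).
  unfold csum; rewrite <- Series_scal_l.
  apply Rle_trans with (Series (fun j => Rabs (cterm n j))).
  - apply Series_Rabs.
    apply (ex_series_le (K := R_AbsRing) (V := R_CompleteNormedModule) _
      (fun j => 2 * odd_inv_sq j)); [|exact H2].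
    intros j; change (Rabs (Rabs (cterm n j)) <= 2 * odd_inv_sq j).
    rewrite Rabs_Rabsolu; apply cterm_abs_le.
  - apply Series_le; [|exact H2].
    intros j; split; [apply Rabs_pos | apply cterm_abs_le].
Qed.

(** Makes the boundary term at infinity vanish in the telescoping sums below. *)
Lemma is_lim_seq_cterm_scal (n : nat) (r : nat -> R) (C : R) :
  (forall j, Rabs (r j) <= C) -> is_lim_seq (fun j => r j * cterm n j) 0.
Proof.
  intros Hr.
  apply is_lim_seq_abs_0.
  apply (is_lim_seq_le_le (fun _ => 0) _ (fun j => C * (2 * odd_inv_sq j))).
  - intros j; split; [apply Rabs_pos|].
    rewrite Rabs_mult; apply Rmult_le_compat; try apply Rabs_pos;
      [apply Hr | apply cterm_abs_le].
  - apply is_lim_seq_const.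
  - replace 0 with (C * (2 * 0)) by ring.
    apply (is_lim_seq_scal_l _ C (2 * 0)), (is_lim_seq_scal_l _ 2 0), is_lim_seq_odd_inv_sq.
Qed.

(* Rational certificate from Zeilberger's algorithm. *)
Definition cert (n j : nat) : R :=
  - (INR n + 1) * INR j
  * (4 * (INR n + 1) * INR j + 4 * INR n ^ 2 + 8 * INR n + 2)
  / (2 * INR j + 2 * INR n + 3) ^ 2.

Lemma cert_abs_le (n j : nat) : Rabs (cert n j) <= 2 * (INR n + 1) ^ 2.
Proof.
  pose proof (pos_INR n); pose proof (pos_INR j); unfold cert.
  set (x := INR n) in *; set (y := INR j) in *.
  replace (- (x + 1) * y * (4 * (x + 1) * y + 4 * x ^ 2 + 8 * x + 2)
           / (2 * y + 2 * x + 3) ^ 2)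
    with (- ((x + 1) * y * (4 * (x + 1) * y + 4 * x ^ 2 + 8 * x + 2)
             / (2 * y + 2 * x + 3) ^ 2)) by (field; lra).
  assert (0 < (2 * y + 2 * x + 3) ^ 2) by (apply pow_lt; lra).
  assert (0 <= (x + 1) * y) by nra.
  assert (0 <= 4 * (x + 1) * y + 4 * x ^ 2 + 8 * x + 2) by nra.
  rewrite Rabs_Ropp, Rabs_pos_eq
    by (apply Rle_mult_inv_pos; [now apply Rmult_le_pos | assumption]).
  apply Rle_div_l; [assumption|].
  (* This splitting lets the two factors of the numerator be bounded separately. *)
  replace (2 * (x + 1) ^ 2 * (2 * y + 2 * x + 3) ^ 2)
    with ((x + 1) * (2 * y + 2 * x + 3) * (2 * (x + 1) * (2 * y + 2 * x + 3))) by ring.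
  apply Rmult_le_compat; nra.
Qed.

Lemma cterm_recurrence (n j : nat) :
  (INR n + 2) ^ 2 * cterm (S (S n)) j
  - (3 * (INR n + 1) ^ 2 + 3 * (INR n + 1) + 1) * cterm (S n) j
  + 2 * (INR n + 1) ^ 2 * cterm n j
  = cert n (S j) * cterm n (S j) - cert n j * cterm n j.
Proof.
  pose proof (pos_INR n); pose proof (pos_INR j).
  rewrite cterm_succ_r; unfold cert; cbn [cterm]; rewrite !S_INR.
  field; repeat split; lra.
Qed.

(** Sum [cterm_recurrence] over [j]: the right side telescopes to 0, since [cert n 0 = 0] and the
    term at infinity vanishes. *)
Lemma csum_recurrence (n : nat) :
  (INR n + 2) ^ 2 * csum (S (S n))
  = (3 * (INR n + 1) ^ 2 + 3 * (INR n + 1) + 1) * csum (S n)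
    - 2 * (INR n + 1) ^ 2 * csum n.
Proof.
  pose proof (is_series_telescope _
    (is_lim_seq_cterm_scal n (cert n) _ (cert_abs_le n))) as Ht.
  apply is_series_unique in Ht.
  rewrite <- (Series_ext _ _ (cterm_recurrence n)) in Ht.
  assert (Hex : forall c m, ex_series (fun j => c * cterm m j))
    by (intros c m; apply (ex_series_scal_l c (cterm m)), ex_series_cterm).
  rewrite Series_plus, Series_minus, !Series_scal_l in Ht; try apply Hex.
  - fold (csum n) (csum (S n)) (csum (S (S n))) in Ht.
    unfold cert in Ht; simpl (INR 0) in Ht; rewrite !Rmult_0_r in Ht.
    unfold Rdiv in Ht; rewrite !Rmult_0_l in Ht; lra.
  - apply (ex_series_minus (fun j => _ * cterm (S (S n)) j)); apply Hex.
Qed.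

Lemma csum_0 : csum 0 = 2 * Catalan.
Proof. apply Series_scal_l. Qed.

(** With [c j = (-1)^j / (2j+1)^2], the difference [cterm 1 j - cterm 0 j] equals [c (j+1) - c j],
    which sums to [- c 0 = -1]. *)
Lemma csum_1 : csum 1 = 2 * Catalan - 1.
Proof.
  set (c j := (-1) ^ j * odd_inv_sq j).
  assert (Hlim : is_lim_seq c 0).
  { apply (is_lim_seq_ext (fun j => / 2 * cterm 0 j)).
    - intros j; unfold c; simpl; field.
    - apply (is_lim_seq_cterm_scal 0 (fun _ => / 2) (Rabs (/ 2))).
      intros _; apply Rle_refl. }
  pose proof (is_series_telescope c Hlim) as Ht.
  unfold csum; rewrite (Series_ext _ (fun j => cterm 0 j + (c (S j) - c j))).
  - rewrite Series_plus; [|apply ex_series_cterm | now eexists; apply Ht].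
    rewrite (is_series_unique _ _ Ht); fold (csum 0); rewrite csum_0.
    unfold c, odd_inv_sq; simpl; field.
  - intros j; pose proof (pos_INR j); unfold c, odd_inv_sq; cbn [cterm].
    unfold odd_inv_sq; rewrite S_INR; simpl pow; simpl INR; field; lra.
Qed.

(** * Solutions of the continued fraction recurrence: growth and remainder *)

Definition cf_solution (y : nat -> R) : Prop :=
  forall n, y (S (S n))
    = (3 * INR (S n) ^ 2 + 17 * INR (S n) + 23) * y (S n)
      + - 2 * INR (S n) * (INR (S n) + 1) * (INR (S n) + 3) ^ 2 * y n.

(** After scaling by [n^2], consecutive ratios obey asymptotically [r -> 3 - 2/r], with fixed points
    1 and 2. The value 3/2 lies between them and is mapped to 5/3, so the bound propagates. The
    initial 24 is [3/2 * 4^2]. *)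
Lemma cf_solution_growth (y : nat -> R) :
  cf_solution y -> 0 <= y 1%nat -> 24 * y 1%nat <= y 2%nat ->
  forall n, 0 <= y (S n) /\ 3 / 2 * (INR n + 4) ^ 2 * y (S n) <= y (S (S n)).
Proof.
  intros Hy H1 H2.
  induction n as [|n [IH0 IH]].
  - simpl INR; split; lra.
  - pose proof (pos_INR n).
    assert (0 <= y (S (S n))) by nra.
    split; [assumption|].
    rewrite (Hy (S n)), !S_INR; set (x := INR n) in *.
    apply Rmult_le_reg_l with (3 / 2 * (x + 4) ^ 2); [nra|].
    assert (2 * (x + 2) * (x + 3) * (x + 5) ^ 2
              * (3 / 2 * (x + 4) ^ 2 * y (S n))
            <= 2 * (x + 2) * (x + 3) * (x + 5) ^ 2 * y (S (S n))).
    { apply Rmult_le_compat_l; [|assumption].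
      repeat apply Rmult_le_pos; try nra. }
    (* Bounding [y (S n)] by [y (S (S n))] through the induction hypothesis leaves this polynomial
       in [x], all of whose coefficients are positive. *)
    assert (0 <= (3 / 2 * (x + 4) ^ 2
                  * (3 * (x + 2) ^ 2 + 17 * (x + 2) + 23 - 3 / 2 * (x + 5) ^ 2)
                  - 2 * (x + 2) * (x + 3) * (x + 5) ^ 2) * y (S (S n))).
    { apply Rmult_le_pos; [|assumption]. ring_simplify.
      assert (0 <= x ^ 2 /\ 0 <= x ^ 3 /\ 0 <= x ^ 4) by (repeat split; apply pow_le; lra).
      lra. }
    nra.
Qed.

(* The polynomial coefficients were found by solving a linear system for them. *)
Lemma cf_solution_remainder (y : nat -> R) :
  cf_solution y -> y 0%nat = 83 - 90 * Catalan ->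
  y 1%nat = 23 * (83 - 90 * Catalan) - 12 ->
  forall n, y n = INR (fact (n + 2)) ^ 2 / (6 * (INR n + 1))
    * ((75 + 137 * INR n + 82 * INR n ^ 2 + 17 * INR n ^ 3 + INR n ^ 4)
         * csum (n + 1)
       - (114 + 190 * INR n + 97 * INR n ^ 2 + 18 * INR n ^ 3 + INR n ^ 4)
         * csum (n + 2)).
Proof.
  intros Hy H0 H1.
  set (rhs n := INR (fact (n + 2)) ^ 2 / (6 * (INR n + 1))
    * ((75 + 137 * INR n + 82 * INR n ^ 2 + 17 * INR n ^ 3 + INR n ^ 4)
         * csum (n + 1)
       - (114 + 190 * INR n + 97 * INR n ^ 2 + 18 * INR n ^ 3 + INR n ^ 4)
         * csum (n + 2))).
  assert (E2 : csum 2 = (7 * csum 1 - 2 * csum 0) / 4)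
    by (pose proof (csum_recurrence 0) as E; simpl INR in E; lra).
  assert (E3 : csum 3 = (19 * csum 2 - 8 * csum 1) / 9)
    by (pose proof (csum_recurrence 1) as E; simpl INR in E; lra).
  (* The recurrence has order two, so two consecutive values are carried along. *)
  assert (H : forall n, y n = rhs n /\ y (S n) = rhs (S n));
    [|intros n; apply H].
  induction n as [|n [IH1 IH2]].
  - rewrite H0, H1; unfold rhs; simpl Nat.add; rewrite E3, E2, csum_1, csum_0.
    simpl fact; simpl INR; split; field.
  - split; [exact IH2|].
    pose proof (pos_INR n).
    pose proof (csum_recurrence (n + 1)) as C3; pose proof (csum_recurrence (n + 2)) as C4.
    rewrite (Hy n), IH1, IH2; unfold rhs.
    replace (n + 1)%nat with (S n) in * by lia; replace (n + 2)%nat with (S (S n)) in * by lia.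
    replace (S n + 1)%nat with (S (S n)) by lia.
    replace (S n + 2)%nat with (S (S (S n))) by lia.
    replace (S (S n) + 1)%nat with (S (S (S n))) by lia.
    replace (S (S n) + 2)%nat with (S (S (S (S n)))) by lia.
    rewrite !fact_simpl, !mult_INR, !S_INR in *.
    (* Eliminate the highest index first, as this reintroduces the next one; then only [csum (n+1)]
       and [csum (n+2)] remain and the claim is a rational identity. *)
    replace (csum (S (S (S (S n))))) with
      (((3 * (INR n + 1 + 1 + 1) ^ 2 + 3 * (INR n + 1 + 1 + 1) + 1) * csum (S (S (S n)))
       - 2 * (INR n + 1 + 1 + 1) ^ 2 * csum (S (S n))) / (INR n + 4) ^ 2)
      by (apply Rmult_eq_reg_l with ((INR n + 4) ^ 2);
          [replace (INR n + 1 + 1 + 2) with (INR n + 4) in C4 by ring; rewrite C4; field; lra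
          |apply pow_nonzero; lra]).
    replace (csum (S (S (S n)))) with
      (((3 * (INR n + 1 + 1) ^ 2 + 3 * (INR n + 1 + 1) + 1) * csum (S (S n))
       - 2 * (INR n + 1 + 1) ^ 2 * csum (S n)) / (INR n + 3) ^ 2)
      by (apply Rmult_eq_reg_l with ((INR n + 3) ^ 2);
          [replace (INR n + 1 + 2) with (INR n + 3) in C3 by ring; rewrite C3; field; lra
          |apply pow_nonzero; lra]).
    field; lra.
Qed.

(** The cube is the growth of the remainder's quartic coefficients over their linear denominator;
    2/3 inverts the growth rate of the denominators. The ratio test applies. *)
Lemma is_lim_seq_cube_geom : is_lim_seq (fun n => (INR n + 2) ^ 3 * (2 / 3) ^ n) 0.
Proof.
  apply ex_series_lim_0, ex_series_Rabs.
  assert (Hpos : forall n, 0 < (INR n + 2) ^ 3 * (2 / 3) ^ n).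
  { intros n; pose proof (pos_INR n).
    apply Rmult_lt_0_compat; apply pow_lt; lra. }
  apply ex_series_DAlembert with (2 / 3); [lra | |].
  - intros n; apply Rgt_not_eq, Hpos.
  - apply (is_lim_seq_ext
      (fun n => 2 / 3 * ((1 + / (INR (S n) + 1)) * (1 + / (INR (S n) + 1))
                         * (1 + / (INR (S n) + 1))))).
    + intros n; rewrite Rabs_pos_eq by (apply Rlt_le, Rdiv_lt_0_compat; apply Hpos).
      pose proof (pos_INR n); rewrite S_INR, <- (tech_pow_Rmult (2 / 3)).
      assert ((2 / 3) ^ n <> 0) by (apply pow_nonzero; lra).
      generalize dependent ((2 / 3) ^ n); intros g Hg; field; repeat split; try assumption; lra.
    + assert (H1 : is_lim_seq (fun n => 1 + / (INR (S n) + 1)) 1).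
      { replace (Finite 1) with (Finite (1 + 0)) by (f_equal; ring).
        apply is_lim_seq_plus'; [apply is_lim_seq_const|].
        apply (is_lim_seq_incr_1 (fun n => / (INR n + 1))), is_lim_seq_inv_succ. }
      replace (Finite (2 / 3)) with (Finite (2 / 3 * (1 * 1 * 1))) by (f_equal; ring).
      apply is_lim_seq_mult'; [apply is_lim_seq_const|].
      repeat apply is_lim_seq_mult'; exact H1.
Qed.

(** Iterating [cf_solution_growth] multiplies up the squares [(k+4)^2] to [((n+3)!/3!)^2], whence
    36. *)
Lemma cf_solution_lower_bound (y : nat -> R) :
  cf_solution y -> y 1%nat = 1 -> y 2%nat = 43 ->
  forall n, INR (fact (n + 3)) ^ 2 * (3 / 2) ^ n / 36 <= y (S n).
Proof.
  intros Hy H1 H2.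
  induction n as [|n IH].
  - rewrite H1; simpl; lra.
  - destruct (cf_solution_growth y Hy ltac:(lra) ltac:(lra) n) as [_ Hn].
    eapply Rle_trans; [|exact Hn].
    replace (S n + 3)%nat with (S (n + 3)) by lia.
    rewrite fact_simpl, mult_INR, S_INR, plus_INR, <- (tech_pow_Rmult (3 / 2)).
    simpl (INR 3); pose proof (pos_INR n).
    replace (((INR n + (1 + 1 + 1) + 1) * INR (fact (n + 3))) ^ 2
             * (3 / 2 * (3 / 2) ^ n) / 36)
      with (3 / 2 * (INR n + 4) ^ 2 * (INR (fact (n + 3)) ^ 2 * (3 / 2) ^ n / 36))
      by field.
    apply Rmult_le_compat_l; [nra | exact IH].
Qed.

Lemma cf_solution_remainder_bound (y : nat -> R) :
  cf_solution y -> y 0%nat = 83 - 90 * Catalan ->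
  y 1%nat = 23 * (83 - 90 * Catalan) - 12 ->
  forall n, Rabs (y (S n))
    <= INR (fact (n + 3)) ^ 2 * (64 * Series odd_inv_sq * (INR n + 2) ^ 3).
Proof.
  intros Hy H0 H1 n.
  rewrite (cf_solution_remainder y Hy H0 H1 (S n)).
  replace (S n + 2)%nat with (n + 3)%nat by lia.
  pose proof (csum_abs_le (S n + 1)) as M1; pose proof (csum_abs_le (n + 3)) as M2.
  rewrite S_INR; pose proof (pos_INR n).
  set (K := Series odd_inv_sq) in *; set (x := INR n) in *.
  set (u := csum (S n + 1)) in *; set (v := csum (n + 3)) in *.
  set (p := 75 + 137 * (x + 1) + 82 * (x + 1) ^ 2 + 17 * (x + 1) ^ 3 + (x + 1) ^ 4).
  set (q := 114 + 190 * (x + 1) + 97 * (x + 1) ^ 2 + 18 * (x + 1) ^ 3 + (x + 1) ^ 4).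
  assert (Hx : 0 <= x ^ 2 /\ 0 <= x ^ 3 /\ 0 <= x ^ 4) by (repeat split; apply pow_le; lra).
  assert (Hp : 0 <= p) by (unfold p; ring_simplify; lra).
  assert (Hq : 0 <= q) by (unfold q; ring_simplify; lra).
  (* The right side is [192 (x+2)^4], which dominates the quartic [p + q] coefficientwise. With both
     [csum] values at most [2 * K] in modulus, 32 becomes 64. *)
  assert (Hpq : p + q <= 32 * (x + 2) ^ 3 * (6 * (x + 1 + 1)))
    by (unfold p, q; ring_simplify; lra).
  assert (HK : 0 <= K) by (pose proof (Rabs_pos u); lra).
  assert (Huv : Rabs (p * u - q * v) <= 64 * K * (x + 2) ^ 3 * (6 * (x + 1 + 1))).
  { apply Rle_trans with ((p + q) * (2 * K)).
    - apply Rabs_le; apply Rabs_le_between in M1; apply Rabs_le_between in M2; nra.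
    - apply Rle_trans with (32 * (x + 2) ^ 3 * (6 * (x + 1 + 1)) * (2 * K));
        [apply Rmult_le_compat_r; lra | right; ring]. }
  replace (INR (fact (n + 3)) ^ 2 / (6 * (x + 1 + 1)) * (p * u - q * v))
    with (INR (fact (n + 3)) ^ 2 * ((p * u - q * v) / (6 * (x + 1 + 1)))) by (field; lra).
  rewrite Rabs_mult, (Rabs_pos_eq (_ ^ 2)) by apply pow2_ge_0.
  apply Rmult_le_compat_l; [apply pow2_ge_0|].
  unfold Rdiv; rewrite Rabs_mult, (Rabs_pos_eq (/ _))
    by (apply Rlt_le, Rinv_0_lt_compat; lra).
  apply Rle_div_l; [lra | exact Huv].
Qed.

(** * Convergence of the continued fraction *)

Theorem corollary2p22 :
  is_CF (fun n : nat => 3 * INR n ^ 2 + 17 * INR n + 23)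
        (fun n : nat => - 2 * INR n * (INR n + 1) * (INR n + 3) ^ 2)
        (12 / (83 - 90 * Catalan)).
Proof.
  unfold is_CF.
  set (A := cf_num _ _); set (B := cf_den _ _); set (c := 83 - 90 * Catalan).
  (* This combination starts with [c] and [23 * c - 12], the initial values required by
     [cf_solution_remainder]. *)
  set (D n := c * A n - 12 * B n).
  assert (HA : cf_solution A) by (unfold cf_solution; reflexivity).
  assert (HB : cf_solution B) by (unfold cf_solution; reflexivity).
  assert (HD : cf_solution D) by (intros n; unfold D; rewrite (HA n), (HB n); ring).
  pose proof (cf_solution_lower_bound B HB eq_refl ltac:(unfold B; simpl; lra)) as HBlow.
  assert (HDup := cf_solution_remainder_bound D HD
    ltac:(unfold D, A, B, c; simpl; ring) ltac:(unfold D, A, B, c; simpl; ring)).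
  assert (Hlow : forall n, 0 < INR (fact (n + 3)) ^ 2 * (3 / 2) ^ n / 36).
  { intros n; pose proof (INR_fact_lt_0 (n + 3)).
    apply Rdiv_lt_0_compat; [|lra].
    apply Rmult_lt_0_compat; apply pow_lt; lra. }
  assert (HBpos : forall n, 0 < B (S n))
    by (intros n; apply Rlt_le_trans with (2 := HBlow n), Hlow).
  assert (Hlim : is_lim_seq (fun n => D (S n) / B (S n)) 0).
  { apply is_lim_seq_abs_0.
    apply (is_lim_seq_le_le (fun _ => 0) _
      (fun n => 36 * 64 * Series odd_inv_sq * ((INR n + 2) ^ 3 * (2 / 3) ^ n))).
    - intros n; split; [apply Rabs_pos|].
      rewrite Rabs_div, (Rabs_pos_eq (B _))
        by (try apply Rgt_not_eq; try apply Rlt_le; apply HBpos).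
      eapply Rle_trans.
      { apply Rmult_le_compat; [apply Rabs_pos | | apply HDup |].
        - apply Rlt_le, Rinv_0_lt_compat, HBpos.
        - apply Rinv_le_contravar; [apply Hlow | apply HBlow]. }
      (* The squared factorials cancel between the two bounds, leaving the cube times [(2/3)^n]. *)
      right; pose proof (INR_fact_lt_0 (n + 3)).
      assert ((3 / 2) ^ n <> 0) by (apply pow_nonzero; lra).
      replace (2 / 3) with (/ (3 / 2)) by field; rewrite pow_inv.
      generalize dependent ((3 / 2) ^ n); intros g Hg.
      field; split; [exact Hg | lra].
    - apply is_lim_seq_const.
    - replace (Finite 0) with (Rbar_mult (36 * 64 * Series odd_inv_sq) 0)
        by (simpl; f_equal; ring).
      apply is_lim_seq_scal_l, is_lim_seq_cube_geom. }
  (* If [c] were 0, [D / B] would be constantly -12 from index 1 on, against its limit 0. *)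
  assert (Hc : c <> 0).
  { intros Hc0.
    assert (H12 : is_lim_seq (fun n => D (S n) / B (S n)) (- 12)).
    { apply (is_lim_seq_ext (fun _ => - 12)); [|apply is_lim_seq_const].
      intros n; unfold D; rewrite Hc0; field; apply Rgt_not_eq, HBpos. }
    apply is_lim_seq_unique in Hlim; apply is_lim_seq_unique in H12.
    rewrite Hlim in H12; injection H12; lra. }
  split.
  - exists 1%nat; intros [|n] Hn; [lia | exact (Rgt_not_eq _ _ (HBpos n))].
  - apply is_lim_seq_incr_1.
    apply (is_lim_seq_ext (fun n => / c * (D (S n) / B (S n) + 12))).
    + intros n; unfold D; field; split; [apply Rgt_not_eq, HBpos | exact Hc].
    + replace (12 / c) with (/ c * (0 + 12)) by (field; exact Hc).
      apply is_lim_seq_mult'; [apply is_lim_seq_const|].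
      apply is_lim_seq_plus'; [exact Hlim | apply is_lim_seq_const].
Qed.
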